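(* The groups $\widetilde{U_3}$ and $\widetilde{L_3}$ are residually nilpotent.
   Context: $\widetilde{U_3}$ is the group given by the presentation with generators $\mu_{12},\mu_{13},\mu_{23}$ and relations $[\mu_{13},\mu_{23}]=1$, $\mu_{13}\mu_{23}\mu_{12}=\mu_{12}\mu_{23}\mu_{13}^{-1}$. $\widetilde{L_3}$ is the group given by the presentation with generators $\mu_{21},\mu_{31},\mu_{32}$ and relations $[\mu_{21},\mu_{31}]=1$, $\mu_{31}\mu_{21}\mu_{32}=\mu_{32}\mu_{21}\mu_{31}^{-1}$. Here $[g,h]=g^{-1}h^{-1}gh$. A group $G$ is residually nilpotent if $\bigcap_{k\ge1}\gamma_k(G)=1$, where $\gamma_k(G)$ is the $k$th term of the lower central series. *)

(* Defs.v *)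
From HB Require Import structures.
From mathcomp Require Import all_boot boolp classical_sets.

Set Implicit Arguments.
Unset Strict Implicit.
Unset Printing Implicit Defensive.

Import Algebra.

Local Open Scope classical_set_scope.
Local Open Scope quotient_scope.

(* Group words over S: the letter (s, true) stands for s, (s, false) for s^-1. *)
Definition word (S : Type) := seq (S * bool).

Definition wgen {S : Type} (s : S) : word S := [:: (s, true)].
Definition winv {S : Type} (w : word S) : word S :=
  [seq (l.1, ~~ l.2) | l <- rev w].
Definition wcomm {S : Type} (u v : word S) : word S :=
  winv u ++ winv v ++ u ++ v.

(* The congruence on words whose quotient is the group < S | u = v, R u v >. *)
Inductive pres_eq (S : Type) (R : word S -> word S -> Prop) :
    word S -> word S -> Prop :=
| pres_eq_rel u v of R u v : pres_eq R u v
| pres_eq_cancel s b : pres_eq R [:: (s, b); (s, ~~ b)] [::]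
| pres_eq_refl u : pres_eq R u u
| pres_eq_sym u v of pres_eq R u v : pres_eq R v u
| pres_eq_trans u v w of pres_eq R u v & pres_eq R v w : pres_eq R u w
| pres_eq_cat u u' v v' of pres_eq R u u' & pres_eq R v v' :
    pres_eq R (u ++ v) (u' ++ v').

Section Presented.
Variables (S : choiceType) (R : word S -> word S -> Prop).

Definition pres_eqb : rel (seq (S * bool)) := fun u v => `[< pres_eq R u v >].

Lemma pres_eqb_equiv : equiv_class_of pres_eqb.
Proof.
split=> [u|u v|v u w].
- exact/asboolP/pres_eq_refl.
- by apply/asboolP/asboolP; apply: pres_eq_sym.
- by move=> /asboolP uv /asboolP vw; apply/asboolP; apply: pres_eq_trans vw.
Qed.

Canonical pres_equiv := EquivRelPack pres_eqb_equiv.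

Definition presented := {eq_quot pres_equiv}.

HB.instance Definition _ := Choice.on presented.
HB.instance Definition _ := EqQuotient.on presented.

Definition wclass (w : word S) : presented := \pi_presented w.

Lemma wclassP u v : wclass u = wclass v <-> pres_eq R u v.
Proof.
split=> [/eqquotP/asboolP //|uv].
by apply/eqquotP/asboolP.
Qed.

Lemma wclass_repr (x : presented) : wclass (repr x) = x.
Proof. exact: reprK. Qed.

Definition pres_one : presented := wclass [::].
Definition pres_mul (x y : presented) : presented := wclass (repr x ++ repr y).
Definition pres_inv (x : presented) : presented := wclass (winv (repr x)).

Lemma pres_mulE u v : pres_mul (wclass u) (wclass v) = wclass (u ++ v).
Proof.
by apply/wclassP/pres_eq_cat; apply/wclassP; rewrite wclass_repr.
Qed.

Lemma winv_cat (u v : word S) : winv (u ++ v) = winv v ++ winv u.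
Proof. by rewrite /winv rev_cat map_cat. Qed.

Lemma winvK : involutive (@winv S).
Proof.
move=> u; rewrite /winv -map_rev revK -map_comp map_id_in // => -[s b] _ /=.
by rewrite negbK.
Qed.

Lemma pres_eq_mulV (u : word S) : pres_eq R (u ++ winv u) [::].
Proof.
elim: u => [|[s b] u IH]; first exact: pres_eq_refl.
have -> : ((s, b) :: u) ++ winv ((s, b) :: u)
    = ([:: (s, b)] ++ (u ++ winv u)) ++ [:: (s, ~~ b)].
  by rewrite -cat1s winv_cat -!catA.
apply: pres_eq_trans (pres_eq_cancel R s b).
apply: (@pres_eq_cat _ _ _ [:: (s, b)]); last exact: pres_eq_refl.
rewrite -[X in pres_eq _ _ X]cats0; apply: pres_eq_cat => //.
exact: pres_eq_refl.
Qed.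

Lemma pres_eq_mulI (u : word S) : pres_eq R (winv u ++ u) [::].
Proof. by have := pres_eq_mulV (winv u); rewrite winvK. Qed.

Lemma pres_eq_winv (u v : word S) : pres_eq R u v -> pres_eq R (winv u) (winv v).
Proof.
move=> uv.
have vuI : pres_eq R (v ++ winv u) [::].
  apply: pres_eq_trans (pres_eq_mulV u).
  by apply: pres_eq_cat (pres_eq_refl _ _); apply: pres_eq_sym.
have h1 : pres_eq R (winv v ++ (v ++ winv u)) (winv v).
  rewrite -[X in pres_eq _ _ X]cats0.
  by apply: pres_eq_cat vuI; apply: pres_eq_refl.
apply: pres_eq_trans h1; rewrite catA; apply: pres_eq_sym.
rewrite -[X in pres_eq _ _ X]cat0s.
by apply: pres_eq_cat (pres_eq_mulI v) (pres_eq_refl _ _).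
Qed.

Lemma pres_invE u : pres_inv (wclass u) = wclass (winv u).
Proof.
by apply/wclassP/pres_eq_winv; apply/wclassP; rewrite wclass_repr.
Qed.

Lemma pres_mulA : associative pres_mul.
Proof.
move=> x y z; rewrite -[x]wclass_repr -[y]wclass_repr -[z]wclass_repr.
by rewrite !pres_mulE catA.
Qed.

Lemma pres_mul1g : left_id pres_one pres_mul.
Proof. by move=> x; rewrite -[x]wclass_repr pres_mulE. Qed.

Lemma pres_mulg1 : right_id pres_one pres_mul.
Proof. by move=> x; rewrite -[x]wclass_repr pres_mulE cats0. Qed.

Lemma pres_mulVg : left_inverse pres_one pres_inv pres_mul.
Proof.
move=> x; rewrite -[x]wclass_repr pres_invE pres_mulE.
exact/wclassP/pres_eq_mulI.
Qed.

Lemma pres_mulgV : right_inverse pres_one pres_inv pres_mul.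
Proof.
move=> x; rewrite -[x]wclass_repr pres_invE pres_mulE.
exact/wclassP/pres_eq_mulV.
Qed.

HB.instance Definition _ := isGroup.Build presented
  pres_mulA pres_mul1g pres_mulg1 pres_mulVg pres_mulgV.

End Presented.

Section UniversalProperty.
Variables (S : choiceType) (R : word S -> word S -> Prop).
Variables (H : groupType) (f : S -> H).
Local Open Scope group_scope.

Definition weval (w : word S) : H :=
  \prod_(l <- w) (if l.2 then f l.1 else (f l.1)^-1).

Hypothesis fR : forall u v, R u v -> weval u = weval v.

Definition pres_lift (x : presented R) : H := weval (repr x).

Lemma weval_eq u v : pres_eq R u v -> weval u = weval v.
Proof.
elim=> {u v} [u v /fR //|s b|//|//|u v w _ -> //|u u' v v' _ IHu _ IHv].
  by rewrite /weval big_cons big_seq1 big_nil; case: b; rewrite ?mulgV ?mulVg.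
by rewrite /weval !big_cat -!/(weval _) IHu IHv.
Qed.

Lemma pres_liftE w : pres_lift (wclass R w) = weval w.
Proof. by apply/weval_eq/wclassP/wclass_repr. Qed.

Lemma pres_lift_gen s : pres_lift (wclass R (wgen s)) = f s.
Proof. by rewrite pres_liftE /weval big_seq1. Qed.

Lemma pres_liftM : {morph pres_lift : x y / x * y}.
Proof.
move=> x y; rewrite -[x]wclass_repr -[y]wclass_repr.
have -> : wclass R (repr x) * wclass R (repr y) = wclass R (repr x ++ repr y).
  exact: pres_mulE.
by rewrite !pres_liftE /weval big_cat.
Qed.

End UniversalProperty.

Inductive U3_gen := mu12 | mu13 | mu23.
HB.instance Definition _ := gen_eqMixin U3_gen.
HB.instance Definition _ := gen_choiceMixin U3_gen.

Inductive U3_rel : word U3_gen -> word U3_gen -> Prop :=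
| U3_rel1 : U3_rel (wcomm (wgen mu13) (wgen mu23)) [::]
| U3_rel2 : U3_rel (wgen mu13 ++ wgen mu23 ++ wgen mu12)
                   (wgen mu12 ++ wgen mu23 ++ winv (wgen mu13)).

Definition U3_tilde : groupType := presented U3_rel.

Inductive L3_gen := mu21 | mu31 | mu32.
HB.instance Definition _ := gen_eqMixin L3_gen.
HB.instance Definition _ := gen_choiceMixin L3_gen.

Inductive L3_rel : word L3_gen -> word L3_gen -> Prop :=
| L3_rel1 : L3_rel (wcomm (wgen mu21) (wgen mu31)) [::]
| L3_rel2 : L3_rel (wgen mu31 ++ wgen mu21 ++ wgen mu32)
                   (wgen mu32 ++ wgen mu21 ++ winv (wgen mu31)).

Definition L3_tilde : groupType := presented L3_rel.

Section LowerCentral.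
Variable G : groupType.
Local Open Scope group_scope.

Definition is_subgroup (H : set G) : Prop :=
  H 1 /\ forall x y, H x -> H y -> H (x / y).

Definition subgroup_gen (A : set G) : set G := smallest is_subgroup A.

Definition commg_sub (A B : set G) : set G :=
  subgroup_gen [set [~ x, y] | x in A & y in B].

(* gamma k is the k-th term for k >= 1; gamma 0 is the junk value G. *)
Definition gamma (k : nat) : set G := iter k.-1 (fun A => commg_sub A setT) setT.

Definition residually_nilpotent : Prop :=
  \bigcap_(k in [set k | (1 <= k)%N]) gamma k = [set 1].

End LowerCentral.

(* Main.v *)
From HB Require Import structures.
From mathcomp Require Import all_boot all_order all_algebra.
From mathcomp Require Import boolp classical_sets functions.
From mathcomp Require Import zify ring.
Require Import Defs.

(** Write [a], [b], [t] for mu13, mu23, mu12.  The relations say that [a] and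
    [b] commute and that [b t b^-1 = a^-1 t a^-1], so the upper group is the
    semidirect product of the free group on [a] and [t] with the infinite cyclic
    group of [b].  On the abelianized free group [b] acts by [t |-> t - 2a],
    which is unipotent, and this is why the extension stays residually nilpotent.

    To make this effective, the group acts on the power series ring Z<<A, T>>
    in noncommuting variables (Magnus): [a] and [t] multiply on the left by
    [1 + A] and [1 + T], and [b] is the ring automorphism that fixes [1 + A] and
    sends [1 + T] to [a^-1 t a^-1].  Give A weight 2 and T weight 1.  Then each
    generator is the identity plus an operator that strictly raises weights
    ([lmul_unip], [subst_unip]).  Commutators of such operators raise weights
    more and more, so [gamma k] acts trivially up to [k] weights, and the
    intersection of the lower central series acts trivially
    ([residually_nilpotent_of_filtered_action]).

    The action is faithful ([U3_act_faithful]).  An element is [b^n w] with [w]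
    reduced in [a] and [t] ([U3_normal_form]).  As [b] fixes the series 1, a
    trivial action forces [w] to fix 1, and a nonempty [w] does not: the
    monomial that alternates A and T once per syllable has coefficient the
    product of the exponents ([reduced_detects]).  Finally [b^n] sends T to
    [T - 2nA + ...] ([iter_subst_A]), so [n = 0].

    The lower group has the same presentation after renaming its generators. *)

Set Implicit Arguments.
Unset Strict Implicit.
Unset Printing Implicit Defensive.

Import Order.TTheory GRing.Theory Num.Theory Algebra.

Local Open Scope classical_set_scope.

(** * Residual nilpotence from a filtered action *)

Lemma subgroup_gen1 (G : groupType) (A : set G) : subgroup_gen A 1%g.
Proof. by move=> B [[]]. Qed.

Lemma gamma1 (G : groupType) k : gamma k (1%g : G).
Proof. by case: k => [|[|k]] //=; apply: subgroup_gen1. Qed.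

Section FilteredAction.
Variables (G : groupType) (V : zmodType) (F : nat -> set V) (act : G -> V -> V).
Local Open Scope ring_scope.

Hypothesis F0 : forall j, F j 0.
Hypothesis FB : forall j u v, F j u -> F j v -> F j (u - v).
Hypothesis F_all : forall v, F 0 v.
Hypothesis F_le : forall i j v, (i <= j)%N -> F j v -> F i v.
Hypothesis F_sep : forall v, (forall j, F j v) -> v = 0.
Hypothesis act1 : forall v, act 1%g v = v.
Hypothesis actM : forall g h v, act (g * h)%g v = act g (act h v).
Hypothesis actB : forall g, {morph act g : u v / u - v}.
Hypothesis act_unip : forall g j v, F j v -> F j.+1 (act g v - v).
Hypothesis act_faithful : forall g, (forall v, act g v = v) -> g = 1%g.

Let FD j u v : F j u -> F j v -> F j (u + v).
Proof.
move=> Fu Fv; rewrite -[v]opprK -[- v]sub0r.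
exact: FB Fu (FB (F0 j) Fv).
Qed.

Let actK g v : act g (act g^-1%g v) = v.
Proof. by rewrite -actM mulgV act1. Qed.

Let F_act g j v : F j v -> F j (act g v).
Proof.
move=> Fv; rewrite -[act g v](subrK v); apply: FD => //.
exact: F_le (act_unip g Fv).
Qed.

(** The elements whose difference with 1 lowers the filtration by [k].  With
    [(x - 1) F_j <= F_(j+k)] and [(y - 1) F_j <= F_(j+1)], the identity
    [xy - yx = (x - 1)(y - 1) - (y - 1)(x - 1)] puts [[~ x, y]] one step
    deeper, so these subgroups bound the lower central series. *)
Definition deep k : set G :=
  [set g | forall j v, F j v -> F (j + k)%N (act g v - v)].

Lemma deep_subgroup k : is_subgroup (deep k).
Proof.
split=> [j v _|x y Dx Dy j v Fv]; first by rewrite act1 subrr.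
set v' := act y^-1%g v.
(* [x - y] splits as [(x - 1) - (y - 1)], applied to [v' = y^-1 v]. *)
have -> : act (x / y)%g v - v = (act x v' - v') - (act y v' - v').
  by rewrite actM -/v' actK opprB addrA subrK.
by apply: FB; [apply: Dx|apply: Dy]; apply: F_act.
Qed.

Lemma deep_comm k x y : deep k x -> deep k.+1 [~ x, y]%g.
Proof.
move=> Dx j v Fv; rewrite commgEl conjgE.
set u := act y v - v; set w := act x v - v.
have Fu : F j.+1 u by apply: act_unip.
have Fw : F (j + k) w by apply: Dx.
(* [[~ x, y] = (yx)^-1 (xy)], and [(yx)^-1] preserves the filtration. *)
have -> : act (x^-1 * (y^-1 * (x * y)))%g v - v
    = act (y * x)^-1%g ((act x u - u) - (act y w - w)).
  have -> : (act x u - u) - (act y w - w) = act (x * y)%g v - act (y * x)%g v.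
    rewrite !actB !actM; set p := act x (act y v); set q := act y (act x v).
    have Eu : act x v + u = act y v + w by rewrite /u /w addrCA.
    by rewrite -[p - _ - _]addrA -[q - _ - _]addrA -!opprD Eu opprB addrA subrK.
  by rewrite actB -!actM invgM -!mulgA mulKg mulVg act1.
apply/F_act/FB; first by rewrite addnS -addSn; apply: Dx.
by rewrite addnS; apply: act_unip.
Qed.

Lemma gamma_deep k : gamma k.+1 `<=` deep k.+1.
Proof.
elim: k => [g _ j v|k IHk]; first by rewrite addn1; apply: act_unip.
apply: smallest_sub; first exact: deep_subgroup.
by move=> _ [x /IHk Dx [y _ <-]]; apply: deep_comm.
Qed.

(** A faithful group of unipotent operators of a separated filtration is
    residually nilpotent: an element of every [gamma k] displaces each vector
    by an element of every [F j], that is, by 0. *)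
Lemma residually_nilpotent_of_filtered_action : residually_nilpotent G.
Proof.
apply/seteqP; split=> [g gg|_ -> k _]; last exact: gamma1.
apply: act_faithful => v; apply/eqP; rewrite -subr_eq0; apply/eqP/F_sep => j.
apply: (@F_le _ (0 + j.+1)) => //.
exact: gamma_deep (gg j.+1 isT) _ _ (F_all v).
Qed.

End FilteredAction.

Section InjectiveMorphism.
Variables (G H : groupType) (f : G -> H).
Local Open Scope group_scope.
Hypothesis fM : {morph f : x y / x * y}.

Let f1 : f 1 = 1.
Proof. by apply: (mulgI (f 1)); rewrite -fM !mulg1. Qed.
Let fV x : f x^-1 = (f x)^-1.
Proof. by apply: (mulgI (f x)); rewrite -fM !mulgV. Qed.

Lemma gamma_morph k g : gamma k g -> gamma k (f g).
Proof.
rewrite /gamma; elim: {k}k.-1 g => //= k IHk.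
suff: commg_sub (iter k (fun A => commg_sub A setT) setT) setT
    `<=` f @^-1` (commg_sub (iter k (fun A => commg_sub A setT) setT) setT) by [].
apply: smallest_sub => [|_ [x gx [y _ <-]]] /=.
  split=> [|x y] /=; first by rewrite f1; apply: subgroup_gen1.
  rewrite fM fV => gx gy B BP.
  by have [[_ BV] _] := BP; apply: BV; [apply: gx|apply: gy].
apply: sub_gen_smallest; exists (f x); first exact: IHk.
by exists (f y) => //; rewrite !commgEl !conjgE !(fM, fV).
Qed.

Lemma residually_nilpotent_inj :
  injective f -> residually_nilpotent H -> residually_nilpotent G.
Proof.
move=> f_inj rnH; apply/seteqP; split=> [g gg|_ -> k _]; last exact: gamma1.
apply: f_inj; rewrite f1.
suff: [set 1] (f g) by [].
by rewrite -rnH => k /gg; apply: gamma_morph.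
Qed.

End InjectiveMorphism.

(** * Noncommutative power series and a unipotent substitution *)

Section Series.
Local Open Scope ring_scope.

(** The ring Z<<A, T>> of noncommutative power series, given by coefficients:
    a list of booleans is a monomial, [true] being A and [false] being T. *)
Notation series := (seq bool -> int).
Implicit Types (f g h : series) (l s : bool) (w : seq bool).

Let evalD f g w : (f + g) w = f w + g w. Proof. by []. Qed.
Let evalB f g w : (f - g) w = f w - g w. Proof. by []. Qed.

Let sub3 (a b c d e f : series) :
  (a + c + e) - (b + d + f) = (a - b) + (c - d) + (e - f).
Proof. by rewrite !opprD addrACA [a + c + _]addrACA. Qed.

(** Left multiplication by the variable [l]. *)
Definition shift l f : series :=
  fun w => if w is x :: w' then if x == l then f w' else 0 else 0.

Definition resid l f : series := fun w => f (l :: w).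

Definition cterm f : series := fun w => if w is [::] then f [::] else 0.

Lemma seriesE f :
  f = cterm f + shift true (resid true f) + shift false (resid false f).
Proof.
by apply/funext => -[|[] w]; rewrite !evalD /= ?add0r ?addr0.
Qed.

Lemma shiftB l : {morph shift l : f g / f - g}.
Proof.
move=> f g; apply/funext => -[|x w]; rewrite !(evalB, evalD) /= ?subr0 //.
by case: ifP; rewrite ?subr0.
Qed.

(** Left multiplication by the inverse of [1 + l]. *)
Fixpoint geom l f w : int :=
  if w is x :: w' then f w - (if x == l then geom l f w' else 0) else f [::].

(** Left multiplication by [1 + l], or by its inverse when [s] is [false]. *)
Definition lmul l s f : series := if s then f + shift l f else geom l f.

Lemma geomE l f : geom l f = f - shift l (geom l f).
Proof. by apply/funext => -[|x w]; rewrite !(evalB, evalD) /= ?subr0. Qed.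

Lemma lmulK l s : cancel (lmul l s) (lmul l (~~ s)).
Proof.
case: s => f /=; last by rewrite [X in X + _]geomE subrK.
apply/funext; elim=> [|x w IHw] /=; first by rewrite addrfctE /= addr0.
rewrite IHw !addrfctE /=; case: ifP; by rewrite ?subr0 ?addr0 ?addrK.
Qed.

Lemma lmulVK l s : cancel (lmul l (~~ s)) (lmul l s).
Proof. by have := lmulK l (~~ s); rewrite negbK. Qed.

Lemma lmulB l s : {morph lmul l s : f g / f - g}.
Proof.
case: s => f g /=.
  by rewrite shiftB opprD !addrA; congr (_ + _); rewrite addrAC.
apply/funext; elim=> [|x w IHw] //.
rewrite evalB /= IHw !evalB; case: ifP => _; first by ring.
by rewrite !subr0.
Qed.

Lemma lmul0 l s : lmul l s 0 = 0.
Proof. by have := lmulB l s 0 0; rewrite !subrr. Qed.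

Lemma lmulD l s : {morph lmul l s : f g / f + g}.
Proof.
by move=> f g; rewrite -[g in LHS]opprK -[- g]sub0r !lmulB lmul0 sub0r opprK.
Qed.

(** The weight 2 for A is what makes the substitution below unipotent: it sends
    T to T +/- 2A + ..., a change of higher weight only if A outweighs T. *)
Definition wt w : nat := sumn [seq if x then 2 else 1 | x <- w].

Definition fil j : set series := [set f | forall w, (wt w < j)%N -> f w = 0].

Lemma fil0 j : fil j 0. Proof. by []. Qed.
Lemma filB j f g : fil j f -> fil j g -> fil j (f - g).
Proof. by move=> Ff Fg w wj; rewrite evalB Ff // Fg // subr0. Qed.
Lemma filD j f g : fil j f -> fil j g -> fil j (f + g).
Proof. by move=> Ff Fg w wj; rewrite evalD Ff // Fg // addr0. Qed.
Lemma fil_all f : fil 0 f. Proof. by []. Qed.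
Lemma fil_le i j f : (i <= j)%N -> fil j f -> fil i f.
Proof. by move=> ij Ff w wi; apply: Ff; apply: leq_trans ij. Qed.
Lemma fil_sep f : (forall j, fil j f) -> f = 0.
Proof. by move=> Ff; apply/funext => w; apply: (Ff (wt w).+1). Qed.

Lemma fil_shift l j f : fil j f -> fil (j + if l then 2 else 1)%N (shift l f).
Proof.
move=> Ff [|x w] //=; case: eqP => // ->; rewrite /wt /= addnC ltn_add2r.
exact: Ff.
Qed.

Lemma fil_resid l j f : fil j f -> fil (j - if l then 2 else 1)%N (resid l f).
Proof. by move=> Ff w; rewrite ltn_subRL => wj; apply: Ff; rewrite /wt /=. Qed.

Lemma fil_geom l j f : fil j f -> fil j (geom l f).
Proof.
move=> Ff; elim=> [|x w IHw] /= wj; first exact: Ff.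
rewrite Ff // sub0r; case: ifP => _; last by rewrite oppr0.
rewrite IHw ?oppr0 //; apply: leq_ltn_trans wj.
by rewrite /wt /= leq_addl.
Qed.

Lemma lmul_unip l s j f :
  fil j f -> fil (j + if l then 2 else 1)%N (lmul l s f - f).
Proof.
move=> Ff; case: s => /=; first by rewrite addrC addKr; apply: fil_shift.
rewrite geomE addrC addKr -[- _]add0r; apply: filB; first exact: fil0.
exact/fil_shift/fil_geom.
Qed.

Lemma fil_lmul l s j f : fil j f -> fil j (lmul l s f).
Proof.
move=> Ff; rewrite -[lmul l s f](subrK f); apply: filD => //.
exact: (fil_le (leq_addr _ _) (lmul_unip s Ff)).
Qed.

(** Left multiplication by [a^s t a^s], where [a = 1 + A] and [t = 1 + T]. *)
Definition lmul_ata s f : series :=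
  lmul true s (lmul false true (lmul true s f)).

(** Left multiplication by the image of T under [subst s] below. *)
Definition twist s f : series := lmul_ata s f - f.

Lemma twistB s : {morph twist s : f g / f - g}.
Proof.
move=> f g; rewrite /twist /lmul_ata !lmulB !opprD !opprK !addrA.
by congr (_ + _); rewrite addrAC.
Qed.

(** [a t a - t = (a^2 - 1) + (a T a - T)], and [a - 1] raises weights by 2. *)
Lemma twist_shift s j f : fil j f -> fil (j + 2)%N (twist s f - shift false f).
Proof.
move=> Ff; rewrite /twist /lmul_ata; set a := lmul true s.
have aU i g : fil i g -> fil (i + 2)%N (a g - g).
  by move=> Fg; exact: (lmul_unip (l:=true) s Fg).
have Faf : fil j (a f) by apply: fil_lmul.
have -> : a (lmul false true (a f)) - f - shift false f =
    ((a (a f) - a f) + (a f - f)) +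
    ((a (shift false (a f)) - shift false (a f)) + shift false (a f - f)).
  rewrite shiftB subrKA subrKA [lmul _ _ _]/(a f + _).
  by rewrite [a (_ + _)]lmulD [in RHS]addrACA addrA.
apply: filD; apply: filD.
- exact: aU.
- exact: aU.
- apply: (fil_le _ (aU _ _ (fil_shift (l:=false) Faf))); lia.
- apply: (fil_le _ (fil_shift (l:=false) (aU _ _ Ff))); lia.
Qed.

Lemma fil_twist s j f : fil j f -> fil j.+1 (twist s f).
Proof.
move=> Ff; rewrite -[twist s f](subrK (shift false f)) -addn1; apply: filD.
  by apply: (fil_le _ (twist_shift s Ff)); rewrite leq_add2l.
exact: (fil_shift (l:=false) Ff).
Qed.

(** Writing [f = f0 + A f1 + T f2], the substitution must send [f] to
    [f0 + A subst f1 + twist (subst f2)].  Both [A] and [twist] raise weights,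
    so [n] unfoldings of this equation fix the coefficients of weight less than
    [n]; [subst] reads each coefficient after enough unfoldings. *)
Fixpoint subst_fuel s n f : series :=
  if n is m.+1 then
    cterm f + shift true (subst_fuel s m (resid true f))
    + twist s (subst_fuel s m (resid false f))
  else 0.

(** The continuous ring endomorphism that fixes [1 + A] and sends [1 + T] to
    [a^s t a^s]. *)
Definition subst s f : series := fun w => subst_fuel s (wt w).+1 f w.

Lemma shift0 l : shift l 0 = 0.
Proof. by have := shiftB l 0 0; rewrite !subrr. Qed.

Lemma twist0 s : twist s 0 = 0.
Proof. by have := twistB s 0 0; rewrite !subrr. Qed.

Lemma subst_fuelB s n : {morph subst_fuel s n : f g / f - g}.
Proof.
elim: n => [|n IHn] f g /=; first by rewrite subrr.
have -> : cterm (f - g) = cterm f - cterm g.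
  by apply/funext => -[|x w]; rewrite evalB //= subrr.
have residB l : resid l (f - g) = resid l f - resid l g by [].
by rewrite !residB !IHn shiftB twistB -sub3.
Qed.

Lemma subst_fuel_stable s n m f :
  (n <= m)%N -> fil n (subst_fuel s m f - subst_fuel s n f).
Proof.
elim: n m f => [|n IHn] [|m] f //= nm.
rewrite sub3 subrr add0r.
rewrite -shiftB -twistB; apply: filD; last exact/fil_twist/IHn.
by apply: (fil_le _ (fil_shift (l:=true) (IHn _ _ nm))); lia.
Qed.

Lemma subst_approx s n f : fil n (subst s f - subst_fuel s n f).
Proof.
move=> w wn; rewrite evalB /subst; apply/eqP; rewrite -oppr_eq0 opprB; apply/eqP.
by rewrite -evalB; apply: (@subst_fuel_stable s (wt w).+1).
Qed.

Lemma substB s : {morph subst s : f g / f - g}.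
Proof.
by move=> f g; apply/funext => w; rewrite /subst subst_fuelB.
Qed.

Lemma substE s f :
  subst s f = cterm f + shift true (subst s (resid true f))
              + twist s (subst s (resid false f)).
Proof.
apply/eqP; rewrite -subr_eq0; apply/eqP/fil_sep => n.
set u := resid true f; set v := resid false f.
rewrite -(subrKA (subst_fuel s n.+1 f)).
apply: filD; first exact: (fil_le (leqnSn n) (@subst_approx s n.+1 f)).
rewrite /= -/u -/v sub3 subrr add0r -shiftB -twistB.
have au g : fil n (subst_fuel s n g - subst s g).
  by rewrite -opprB -sub0r; apply: filB; [exact: fil0|exact: subst_approx].
apply: filD; last exact: (fil_le (leqnSn n) (fil_twist s (au v))).
by apply: (fil_le _ (fil_shift (l:=true) (au u))); lia.
Qed.

Lemma subst0 s : subst s 0 = 0.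
Proof. by have := substB s 0 0; rewrite !subrr. Qed.

Lemma substD s : {morph subst s : f g / f + g}.
Proof.
by move=> f g; rewrite -[g in LHS]opprK -[- g]sub0r !substB subst0 sub0r opprK.
Qed.

Lemma subst_cterm s f : subst s (cterm f) = cterm f.
Proof.
rewrite substE; have residc l : resid l (cterm f) = 0 by [].
rewrite !residc subst0 shift0 twist0 !addr0.
by apply/funext => -[].
Qed.

Lemma subst_shift_true s f : subst s (shift true f) = shift true (subst s f).
Proof.
rewrite substE.
have -> : cterm (shift true f) = 0 by apply/funext => -[].
have -> : resid true (shift true f) = f by [].
have -> : resid false (shift true f) = 0 by [].
by rewrite subst0 twist0 add0r addr0.
Qed.

Lemma subst_shift_false s f : subst s (shift false f) = twist s (subst s f).
Proof.
rewrite substE.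
have -> : cterm (shift false f) = 0 by apply/funext => -[].
have -> : resid true (shift false f) = 0 by [].
have -> : resid false (shift false f) = f by [].
by rewrite subst0 shift0 !add0r.
Qed.

Lemma subst_lmul_true s e f : subst s (lmul true e f) = lmul true e (subst s f).
Proof.
have pos g : subst s (lmul true true g) = lmul true true (subst s g).
  by rewrite substD subst_shift_true.
case: e; first exact: pos.
apply: (can_inj (lmulK true true)).
by rewrite -pos !(lmulK true false).
Qed.

Lemma subst_lmul_false s f :
  subst s (lmul false true f) = lmul_ata s (subst s f).
Proof. by rewrite substD subst_shift_false addrC subrK. Qed.

(** Uniqueness principle for operators satisfying a recursion like that of
    [subst]. *)
Lemma series_contraction (D : series -> series) :
  (forall f, D f = shift true (D (resid true f))
                   + shift false (D (resid false f))) ->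
  forall f, D f = 0.
Proof.
move=> DE f; apply/funext => w; elim: w f => [|x w IHw] f; rewrite DE evalD /=.
  by rewrite addr0.
by case: x => /=; rewrite IHw ?addr0 ?add0r.
Qed.

(** The two substitutions are inverse automorphisms, because
    [a^-1 (a t a) a^-1 = t]. *)
Lemma substK s : cancel (subst s) (subst (~~ s)).
Proof.
move=> f; apply/eqP; rewrite -subr_eq0; apply/eqP; move: f.
apply: series_contraction => f.
rewrite [subst s f]substE 2!substD subst_cterm subst_shift_true.
rewrite /twist substB {1}/lmul_ata.
rewrite subst_lmul_true subst_lmul_false subst_lmul_true.
rewrite /lmul_ata (lmulK true s) (lmulVK true s).
rewrite [lmul false true _ - _]addrAC subrr add0r.
by rewrite [X in _ - X]seriesE sub3 subrr add0r !shiftB.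
Qed.

(** The recursive equation bootstraps: the difference raises weights through
    the smaller series [f1], [f2], and [twist] agrees with T to higher order.
    The minimum caps the claim at the depth reached by the recursion. *)
Lemma subst_unip s j f : fil j f -> fil j.+1 (subst s f - f).
Proof.
move=> Ff; suff P n : forall j f, fil j f -> fil (minn n j.+1) (subst s f - f).
  by have := P j.+1 j f Ff; rewrite minnn.
elim: n => [|n IHn] {Ff f}j f Ff; first by rewrite min0n.
have -> : subst s f - f = shift true (subst s (resid true f) - resid true f)
    + (twist s (subst s (resid false f) - resid false f)
       + (twist s (resid false f) - shift false (resid false f))).
  by rewrite substE [X in _ - X]seriesE sub3 subrr add0r -shiftB twistB subrKA.
apply: filD; last apply: filD.
- by apply: (fil_le _ (fil_shift (l:=true) (IHn _ _ (fil_resid (l:=true) Ff)))); lia.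
- by apply: (fil_le _ (fil_twist s (IHn _ _ (fil_resid (l:=false) Ff)))); lia.
- by apply: (fil_le _ (twist_shift s (fil_resid (l:=false) Ff))); lia.
Qed.

Lemma subst_nil s f : subst s f [::] = f [::].
Proof.
by rewrite substE !evalD /= /twist evalB /lmul_ata; case: s => /=;
  do ?rewrite evalD /=; ring.
Qed.

Lemma subst_T s f : subst s f [:: false] = f [:: false].
Proof.
rewrite substE !evalD /= /twist evalB /lmul_ata.
by case: s => /=; do ?rewrite evalD /=; rewrite ?subst_nil /resid; ring.
Qed.

(** The T-coefficient leaks into the A-coefficient, which shows that no power
    of the substitution is trivial. *)
Lemma subst_A s f : subst s f [:: true] =
  f [:: true] + (if s then 2 else -2) * f [:: false].
Proof.
rewrite substE !evalD /= subst_nil /twist evalB /lmul_ata.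
by case: s => /=; do ?rewrite evalD /=; rewrite ?subst_nil /resid; ring.
Qed.

End Series.

(** * Freeness of 1 + A and 1 + T *)

Section ReducedWords.
Local Open Scope ring_scope.
Notation series := (seq bool -> int).

Definition one : series := fun w => (w == [::])%:R.

Definition sgn (s : bool) : int := if s then 1 else -1.

Definition wmul (w : seq (bool * bool)) (f : series) : series :=
  foldr (fun x => lmul x.1 x.2) f w.

Definition compatible (x y : bool * bool) := (x.1 == y.1) ==> (x.2 == y.2).
Definition reduced (w : seq (bool * bool)) := sorted compatible w.

(** The monomial that keeps one letter per syllable of a reduced word has as
    coefficient in the product the product of the syllable exponents.  Read from
    the right: [u] has a letter for each finished syllable, [l] is the current
    one, and [g (l :: u) / g u] is its exponent so far, of sign [s]; monomials
    with more alternations ending in [l :: u] do not occur yet. *)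
Definition detects s l u (g : series) :=
  [/\ ohead u != Some l, 0 < sgn s * g (l :: u) * g u
    & forall v, g (v ++ [:: ~~ l, l & u]) = 0].

Lemma lmul_away l s g u : ohead u != Some l -> lmul l s g u = g u.
Proof.
case: s; case: u => [|x u] //=; rewrite ?addrfctE /=.
- by rewrite addr0.
- by case: (x =P l) => [->|_ _]; rewrite ?eqxx ?addr0.
- by case: (x =P l) => [->|_ _]; rewrite ?eqxx ?subr0.
Qed.

Lemma lmul_head l s g u :
  ohead u != Some l -> lmul l s g (l :: u) = g (l :: u) + sgn s * g u.
Proof.
move=> hu; case: s (lmul_away false g hu) => /= Eu.
  by rewrite addrfctE /= eqxx mul1r.
by rewrite eqxx Eu mulN1r.
Qed.

Lemma lmul_vanish l s g w :
  (forall v, g (v ++ ~~ l :: w) = 0) -> forall v, lmul l s g (v ++ ~~ l :: w) = 0.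
Proof.
move=> g0 v; case: s => /=.
  rewrite addrfctE /= g0 add0r.
  by case: v => [|x v] /=; rewrite ?g0 ?if_same //; case: l {g0}.
elim: v => [|x v IHv] /=; last by rewrite IHv if_same -cat_cons g0.
by rewrite -[_ :: w]cat0s g0 sub0r; case: l {g0}.
Qed.

Lemma detects_same s l u g : detects s l u g -> detects s l u (lmul l s g).
Proof.
case=> hu pos vanish; split=> //; last exact: lmul_vanish.
rewrite lmul_head // lmul_away //.
by move: pos; rewrite /sgn; case: s; nia.
Qed.

Lemma detects_new s l u g :
    ohead u != Some l -> g u != 0 -> (forall v, g (v ++ l :: u) = 0) ->
  detects s l u (lmul l s g).
Proof.
move=> hu gu vanish; split=> //; last first.
  by apply: lmul_vanish => v; rewrite -cat_rcons vanish.
rewrite lmul_head // lmul_away // -[l :: u]cat0s vanish add0r.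
by move: gu; rewrite /sgn; case: s; nia.
Qed.

Lemma reduced_detects x w :
  reduced (x :: w) -> exists u, detects x.2 x.1 u (wmul (x :: w) one).
Proof.
elim: w x => [|y w IHw] x.
  by exists [::]; apply: detects_new => // -[].
move=> /= /andP[xy /IHw[u]] /=; set g := lmul _ _ _ => gu.
have [Exy|] := eqVneq x.1 y.1.
  have Exy2 : x.2 = y.2 by move: xy; rewrite /compatible Exy eqxx => /eqP.
  by exists u; rewrite Exy Exy2; apply: detects_same.
move=> nxy; have {nxy xy} -> : x.1 = ~~ y.1 by case: x.1 nxy; case: y.1.
case: gu => hu pos vanish.
exists (y.1 :: u); apply: detects_new => //=.
- by case: y.1.
- by apply: contraTneq pos => ->; rewrite mulr0 mul0r ltxx.
Qed.

Lemma reduced_wmul_one w : reduced w -> wmul w one = one -> w = [::].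
Proof.
case: w => // x w /reduced_detects[u [_ pos _]] E; move: pos; rewrite E.
by rewrite /one /= mulr0 mul0r ltxx.
Qed.

Lemma subst_one s : subst s one = one.
Proof.
have -> : one = cterm one by apply/funext => -[|x w].
exact: subst_cterm.
Qed.

Lemma iter_substK n s : cancel (iter n (subst s)) (iter n (subst (~~ s))).
Proof. by elim: n => [|n IHn] f //; rewrite iterSr [iter _ _ f]iterS substK IHn. Qed.

Lemma iter_subst_T n s f : iter n (subst s) f [:: false] = f [:: false].
Proof. by elim: n => //= n IHn; rewrite subst_T. Qed.

Lemma iter_subst_A n s f :
  iter n (subst s) f [:: true]
  = f [:: true] + n%:R * ((if s then 2 else -2) * f [:: false]).
Proof.
elim: n => [|n IHn]; first by rewrite mul0r addr0.
by rewrite iterS subst_A iter_subst_T IHn {IHn}; case: s; lia.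
Qed.

End ReducedWords.

(** * Words in a presented group *)

Section PresentedGroups.
Local Open Scope group_scope.
Variables (S : choiceType) (R : word S -> word S -> Prop).

Definition letter (x : S * bool) : presented R := wclass R [:: x].

Lemma letter_mul x w : letter x * wclass R w = wclass R (x :: w).
Proof. exact: pres_mulE. Qed.

Lemma letterV s e : letter (s, ~~ e) = (letter (s, e))^-1.
Proof. by rewrite [RHS]pres_invE. Qed.

Lemma presented_ind (P : presented R -> Prop) :
  P 1 -> (forall x g, P g -> P (letter x * g)) -> forall g, P g.
Proof.
move=> P1 PM g; rewrite -[g]wclass_repr; elim: (repr g) => // x w IHw.
by rewrite -letter_mul; apply: PM.
Qed.

Lemma weval_cons (H : groupType) (f : S -> H) x w :
  weval f (x :: w) = (if x.2 then f x.1 else (f x.1)^-1) * weval f w.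
Proof. exact: big_cons. Qed.

Lemma weval_gen w : weval (fun s => letter (s, true)) w = wclass R w.
Proof.
elim: w => [|[s e] w IHw]; first by rewrite /weval big_nil.
rewrite weval_cons IHw -letter_mul.
by case: e => //=; rewrite -letterV.
Qed.

End PresentedGroups.

(** * The action of the upper group *)

Section U3.
Local Open Scope ring_scope.
Notation series := (seq bool -> int).
Notation letter := (letter U3_rel).

(** With [a], [b], [t] for mu13, mu23, mu12 the relations give
    [b t b^-1 = a^-1 t a^-1], hence the sign [~~ x.2]. *)
Definition U3_op (x : U3_gen * bool) : series -> series :=
  match x.1 with
  | mu12 => lmul false x.2
  | mu13 => lmul true x.2
  | mu23 => subst (~~ x.2)
  end.

Definition wact (w : word U3_gen) (f : series) : series := foldr U3_op f w.

Lemma U3_opK s e : cancel (U3_op (s, e)) (U3_op (s, ~~ e)).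
Proof. by case: s; [apply: lmulK|apply: lmulK|apply: substK]. Qed.

Lemma wact_eq u v : pres_eq U3_rel u v -> wact u =1 wact v.
Proof.
elim=> {u v} [u v uv|s e|u|u v _ IH|u v w _ IH1 _ IH2|u u' v v' _ IH1 _ IH2] f //=.
- case: uv.
    change (lmul true false (subst true (lmul true true (subst false f))) = f).
    by rewrite subst_lmul_true (lmulK true true) (substK false).
  change (lmul true true (subst false (lmul false true f))
          = lmul false true (subst false (lmul true false f))).
  by rewrite subst_lmul_false subst_lmul_true; apply: (lmulVK true true).
- by have := U3_opK s (~~ e) f; rewrite negbK.
- by rewrite IH1 IH2.
- by rewrite /wact !foldr_cat -!/(wact _ _) IH2 IH1.
Qed.

Definition U3_act (g : U3_tilde) : series -> series := wact (repr g).

Lemma U3_act_wclass w : U3_act (wclass U3_rel w) =1 wact w.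
Proof. by apply/wact_eq/wclassP/wclass_repr. Qed.

Lemma U3_act1 f : U3_act 1%g f = f.
Proof. exact: U3_act_wclass. Qed.

Lemma U3_actM g h f : U3_act (g * h)%g f = U3_act g (U3_act h f).
Proof. by rewrite U3_act_wclass /wact foldr_cat. Qed.

Lemma U3_act_letter x f : U3_act (letter x) f = U3_op x f.
Proof. exact: U3_act_wclass. Qed.

Lemma U3_opB x : {morph U3_op x : f g / f - g}.
Proof. by case: x => -[] e f g; rewrite /U3_op /= ?lmulB ?substB. Qed.

Lemma U3_actB g : {morph U3_act g : f h / f - h}.
Proof.
by move=> f h; rewrite /U3_act; elim: (repr g) => //= x w ->; rewrite U3_opB.
Qed.

Lemma U3_op_unip x j f : fil j f -> fil j.+1 (U3_op x f - f).
Proof.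
case: x => -[] e Ff; rewrite /U3_op /=; last exact: subst_unip.
  by rewrite -addn1; exact: (lmul_unip (l:=false) e Ff).
by apply: (fil_le _ (lmul_unip (l:=true) e Ff)); rewrite addn2.
Qed.

Lemma U3_act_unip g j f : fil j f -> fil j.+1 (U3_act g f - f).
Proof.
move=> Ff; rewrite /U3_act; elim: (repr g) => [|x w IHw] /=; first by rewrite subrr.
rewrite -(subrKA (wact w f)); apply: filD => //; apply: U3_op_unip.
rewrite -[wact w f](subrK f); apply: filD => //.
exact: (fil_le (leqnSn j) IHw).
Qed.

Local Open Scope group_scope.

Definition fletter (x : bool * bool) : U3_tilde :=
  letter (if x.1 then mu13 else mu12, x.2).
Definition fprod (w : seq (bool * bool)) : U3_tilde :=
  foldr (fun x => *%g (fletter x)) 1 w.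

Lemma U3_commute e s : commute (letter (mu13, e)) (letter (mu23, s)).
Proof.
have C : commute (letter (mu13, true)) (letter (mu23, true)).
  apply/commgP/eqP; have /wclassP := pres_eq_rel U3_rel1.
  by rewrite -!weval_gen /weval /wcomm /= !big_cons big_nil /= mulg1.
have C2 : commute (letter (mu13, true)) (letter (mu23, s)).
  by case: s => //; rewrite (letterV _ _ true); apply: commuteV.
case: e => //; rewrite (letterV _ _ true).
by apply/commute_sym/commuteV/commute_sym.
Qed.

(** The second relation reads [t b = a b t a], and [a b = b a]: conjugation by [b] preserves the
    subgroup generated by [a] and [t]. *)
Lemma U3_conj e s :
  letter (mu12, e) ^ letter (mu23, s)
  = letter (mu13, e == s) * letter (mu12, e) * letter (mu13, e == s).
Proof.
set a := letter (mu13, true); set b := letter (mu23, true).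
set t := letter (mu12, true).
have ab : a ^ b = a by rewrite conjgE U3_commute mulKg.
have tb : t ^ b = a * t * a.
  have /wclassP := pres_eq_rel U3_rel2.
  rewrite -!weval_gen /weval /= !big_cons !big_nil /= !mulg1 -/a -/b -/t => E.
  rewrite conjgE; apply: (mulgI b); rewrite mulVKg !mulgA.
  have <- : a * b = b * a by apply: U3_commute.
  by rewrite !mulgA in E; rewrite E mulgVK.
have tbV : t ^ b^-1 = a^-1 * t * a^-1.
  apply: (@conjg_inj _ b); rewrite -conjgM mulVg conjg1 !conjMg conjVg ab tb.
  by rewrite !mulgA mulVg mul1g mulgK.
case: e; case: s => /=; rewrite ?(letterV _ mu12 true) ?(letterV _ mu13 true)
  ?(letterV _ mu23 true) -/a -/b -/t ?conjVg ?tb ?tbV //.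
all: by rewrite !invgM ?invgK mulgA.
Qed.

Definition free_part (g : U3_tilde) := exists2 w, reduced w & g = fprod w.

Lemma free_partM x g : free_part g -> free_part (fletter x * g).
Proof.
move=> [w rw ->]; case: w rw => [|y w] rw; first by exists [:: x].
have [xy|] := boolP (compatible x y); first by exists [:: x, y & w]; rewrite //= xy.
rewrite /compatible negb_imply => /andP[/eqP E1 nE2].
exists w; first exact: path_sorted rw.
rewrite /= mulgA /fletter E1.
have -> : y.2 = ~~ x.2 by case: x.2 nE2; case: y.2.
by rewrite letterV mulgV mul1g.
Qed.

(** Each factor [b] that [t] crosses surrounds it by two letters [a], which
    themselves commute with the remaining factors. *)
Lemma free_part_moveT e s n g : free_part g ->
  exists2 h, free_part h
    & letter (mu12, e) * (letter (mu23, s) ^+ n * g) = letter (mu23, s) ^+ n * h.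
Proof.
elim: n g => [|n IHn] g Fg.
  exists (letter (mu12, e) * g); last by rewrite !expg0 !mul1g.
  exact: (free_partM (false, e)).
have [h Fh E] := IHn _ (free_partM (true, e == s) Fg).
exists (letter (mu13, e == s) * h); first exact: (free_partM (true, e == s)).
have C : commute (letter (mu13, e == s)) (letter (mu23, s) ^+ n).
  exact/commuteX/U3_commute.
rewrite expgS !mulgA [letter _ * letter _]conjgC U3_conj -!mulgA; congr (_ * _).
by rewrite [RHS]mulgA -C -[RHS]mulgA -E [_ * (_ * g)]mulgA C -mulgA.
Qed.

(** The group is the semidirect product of its subgroup generated by [a] and [t]
    with the powers of [b]. *)
Lemma U3_normal_form (g : U3_tilde) :
  exists s n, exists2 h, free_part h & g = letter (mu23, s) ^+ n * h.
Proof.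
elim/presented_ind: g => [|[[] e] _ [s [n [h Fh ->]]]].
- by exists true, 0%N, 1; [exists [::]|rewrite mul1g].
- have [h' Fh' ->] := free_part_moveT e s n Fh.
  by exists s, n, h'.
- exists s, n, (letter (mu13, e) * h); first exact: (free_partM (true, e)).
  have C : commute (letter (mu13, e)) (letter (mu23, s) ^+ n).
    exact/commuteX/U3_commute.
  by rewrite mulgA C mulgA.
- have [->|/eqP nes] := eqVneq e s.
    by exists s, n.+1, h => //; rewrite expgS mulgA.
  have -> : e = ~~ s by case: e nes; case: s.
  case: n => [|n]; last first.
    by exists s, n, h; rewrite // letterV expgS -mulgA mulKg.
  by exists (~~ s), 1%N, h; rewrite // mulgA mulg1.
Qed.

Lemma U3_act_free_part w f : U3_act (fprod w) f = wmul w f.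
Proof.
elim: w => [|[l e] w IHw]; first exact: U3_act1.
by rewrite U3_actM U3_act_letter IHw; case: l.
Qed.

Lemma U3_act_bX s n f :
  U3_act (letter (mu23, s) ^+ n) f = iter n (subst (~~ s)) f.
Proof.
elim: n => [|n IHn]; first exact: U3_act1.
by rewrite expgS U3_actM U3_act_letter IHn.
Qed.

(** Substitutions fix the series 1, so applying [b^n w] to 1 shows that [w] is
    empty; applying [b^n] to T then shows that [n] is 0. *)
Lemma U3_act_faithful g : (forall f, U3_act g f = f) -> g = 1.
Proof.
have [s [n [_ [w rw ->] ->]]] := U3_normal_form g => triv.
have E f : iter n (subst (~~ s)) (wmul w f) = f.
  by rewrite -U3_act_free_part -U3_act_bX -U3_actM.
have w0 : w = [::].
  apply: reduced_wmul_one rw _.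
  rewrite -[LHS](iter_substK n (~~ s)) E.
  by elim: n {E triv} => //= n ->; rewrite subst_one.
have := congr1 (fun f => f [:: true]) (E (shift false one)).
rewrite w0 /= iter_subst_A /= /one /= add0r mulr1.
case: n {E triv} => [|n]; first by rewrite !mul1g.
by case: s => /= n0; exfalso; lia.
Qed.

Lemma U3_residually_nilpotent : residually_nilpotent U3_tilde.
Proof.
apply: (residually_nilpotent_of_filtered_action (F := fil) (act := U3_act)).
- exact: fil0.
- exact: filB.
- exact: fil_all.
- by move=> i j f ij; apply: fil_le.
- exact: fil_sep.
- exact: U3_act1.
- exact: U3_actM.
- exact: U3_actB.
- exact: U3_act_unip.
- exact: U3_act_faithful.
Qed.

End U3.

(** * The lower group *)

Section L3.
Local Open Scope group_scope.

(** Matching mu21, mu31, mu32 with mu23, mu13, mu12 identifies the second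
    relations and inverts the commutator in the first ones. *)
Definition L3_to_U3_gen (s : L3_gen) : U3_tilde :=
  letter U3_rel (match s with mu21 => mu23 | mu31 => mu13 | mu32 => mu12 end, true).
Definition U3_to_L3_gen (s : U3_gen) : L3_tilde :=
  letter L3_rel (match s with mu23 => mu21 | mu13 => mu31 | mu12 => mu32 end, true).

Lemma L3_to_U3_rel u v : L3_rel u v -> weval L3_to_U3_gen u = weval L3_to_U3_gen v.
Proof.
case.
  rewrite /weval /wcomm /= !big_cons !big_nil /= mulg1.
  exact/eqP/commgP/commute_sym/U3_commute.
have /wclassP := pres_eq_rel U3_rel2.
by rewrite -!weval_gen /weval /= !big_cons !big_nil.
Qed.

Lemma U3_to_L3_rel u v : U3_rel u v -> weval U3_to_L3_gen u = weval U3_to_L3_gen v.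
Proof.
case; last first.
  have /wclassP := pres_eq_rel L3_rel2.
  by rewrite -!weval_gen /weval /= !big_cons !big_nil.
have /wclassP := pres_eq_rel L3_rel1.
rewrite -!weval_gen /weval /wcomm /= !big_cons !big_nil /= !mulg1 => E.
by apply/eqP/commgP/commute_sym/commgP/eqP.
Qed.

Definition L3_to_U3 : L3_tilde -> U3_tilde := pres_lift L3_to_U3_gen.
Definition U3_to_L3 : U3_tilde -> L3_tilde := pres_lift U3_to_L3_gen.

Lemma L3_to_U3K : cancel L3_to_U3 U3_to_L3.
Proof.
have fM : {morph L3_to_U3 : x y / x * y} := pres_liftM L3_to_U3_rel.
have gM : {morph U3_to_L3 : x y / x * y} := pres_liftM U3_to_L3_rel.
elim/presented_ind => [|[s e] g IHg].
  rewrite /L3_to_U3 (pres_liftE L3_to_U3_rel) /weval big_nil.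
  by rewrite /U3_to_L3 (pres_liftE U3_to_L3_rel) /weval big_nil.
rewrite fM gM IHg; congr (_ * _).
rewrite /L3_to_U3 (pres_liftE L3_to_U3_rel) /weval big_seq1.
case: e; case: s => /=; rewrite -?letterV /U3_to_L3 (pres_liftE U3_to_L3_rel);
  by rewrite /weval big_seq1 //= -letterV.
Qed.

Lemma L3_residually_nilpotent : residually_nilpotent L3_tilde.
Proof.
apply: (residually_nilpotent_inj (pres_liftM L3_to_U3_rel)).
  exact: can_inj L3_to_U3K.
exact: U3_residually_nilpotent.
Qed.

End L3.

Theorem theorem5p3 :
  residually_nilpotent U3_tilde /\ residually_nilpotent L3_tilde.
Proof. by split; [apply: U3_residually_nilpotent|apply: L3_residually_nilpotent]. Qed.
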